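(* Let $f:\mathbb{R}^2\to\mathbb{R}^2$, $f(x,y)=\mathbf a+\mathbf b x+\mathbf c y+\mathbf d xy$, be a non-degenerate bi-affine map with folding line $L_f$ and folding parabola $P_f=f(L_f)$. Use the notation $L_a$ for the line $x=a$ and $L_b$ for the line $y=b$. For a point $A\in L_f$ let $T_A$ denote the tangent line to $P_f$ at $f(A)$. 1. If $A=(a,b)$ is any point on the folding line $L_f$, then $T_A=f(L_a)=f(L_b)$. 2. If $\mathbf p=(a,b)\in\mathbb{R}^2$, then $f(\mathbf p)=T_A\cap T_B$, where $A=L_f\cap L_a$ and $B=L_f\cap L_b$. 3. $f(L_+)=f(L_-)=\widehat{P_f}$ and, in particular, $f(\mathbf p)=f(\mathbf p^* )$ for all $\mathbf p=(x,y)\in\mathbb{R}^2$.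
   Context: A function $f:\mathbb{R}^2\to\mathbb{R}^2$ is bi-affine if it has the form $f(x,y)=\mathbf a+\mathbf b x+\mathbf c y+\mathbf d xy$ with $\mathbf a,\mathbf b,\mathbf c,\mathbf d\in\mathbb{R}^2$. It is non-degenerate if $\mathbf d\neq\mathbf 0$ and neither $\mathbf b$ nor $\mathbf c$ is a scalar multiple of $\mathbf d$. For $\mathbf u,\mathbf v\in\mathbb{R}^2$, $|\mathbf u\ \mathbf v|$ denotes the determinant of the $2\times 2$ matrix whose columns are $\mathbf u,\mathbf v$. The folding line $L_f$ of a non-degenerate bi-affine $f$ is the line with equation $|\mathbf b\ \mathbf d|\,x+|\mathbf d\ \mathbf c|\,y=|\mathbf c\ \mathbf b|$; it is not parallel to either coordinate axis, since $|\mathbf b\ \mathbf d|$ and $|\mathbf d\ \mathbf c|$ are nonzero. $L_+$ and $L_-$ are the closed half planes above and below $L_f$, respectively. The image $P_f=f(L_f)$ is a non-degenerate parabola, called the folding parabola. A parabola $P$ divides the plane into two regions; $\widehat{P}$ denotes the closed region ''outside'' $P$ (the side not containing the focus), including $P$ itself. For $\mathbf p=(x,y)\in\mathbb{R}^2$, $$\mathbf p^*=\left(\frac{|\mathbf c\ \mathbf b|-|\mathbf d\ \mathbf c|\,y}{|\mathbf b\ \mathbf d|},\ \frac{|\mathbf c\ \mathbf b|-|\mathbf b\ \mathbf d|\,x}{|\mathbf d\ \mathbf c|}\right).$$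
   Formalization: In part 2 the equality of T_A ∩ T_B with the single point f(p) is stated only for p not on L_f (for p on L_f, A = B = p and T_A ∩ T_B is a whole line); for every p it is stated that f(p) lies in T_A ∩ T_B. *)

(* Defs.v *)
From HB Require Import structures.
From mathcomp Require Import all_boot all_order all_algebra.
From mathcomp Require Import all_classical all_reals all_analysis.

Set Implicit Arguments.
Unset Strict Implicit.
Unset Printing Implicit Defensive.

Import Order.TTheory GRing.Theory Num.Theory.
Import numFieldNormedType.Exports.
Local Open Scope classical_set_scope.
Local Open Scope ring_scope.

Definition det2 (R : realType) (u v : R * R) : R :=
  \det (\matrix_(i < 2, j < 2)
          let w := if j == 0 then u else v in if i == 0 then w.1 else w.2).

(* The norm that the library puts on [R * R] is the max norm, so the Euclidean
   metric is defined here; both induce the same topology. *)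
Definition eucl_dist (R : realType) (p q : R * R) : R :=
  Num.sqrt ((p.1 - q.1) ^+ 2 + (p.2 - q.2) ^+ 2).

Definition dist_to_set (R : realType) (p : R * R) (S : set (R * R)) : R :=
  inf [set eucl_dist p q | q in S].

Definition line (R : realType) (u v w : R) : set (R * R) :=
  [set p | u * p.1 + v * p.2 = w].

Definition is_line (R : realType) (l : set (R * R)) : Prop :=
  exists u v w : R, (u, v) != 0 /\ l = line u v w.

Definition vertical_line (R : realType) (s : R) : set (R * R) := [set p | p.1 = s].
Definition horizontal_line (R : realType) (t : R) : set (R * R) := [set p | p.2 = t].

(* Focus-directrix definition, the focus lying off the directrix: [P] is a
   non-degenerate parabola exactly when it has a focus in this sense. *)
Definition is_focus (R : realType) (P : set (R * R)) (F : R * R) : Prop :=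
  exists l : set (R * R),
    [/\ is_line l, ~ l F & P = [set p | eucl_dist p F = dist_to_set p l]].

(* The regions into which [P] divides the plane are the connected components of
   its complement.  The points of [P] lie in none of them, so the points outside
   the component of the focus form the other side together with [P] itself.
   This set is empty when [P] is not a parabola. *)
Definition outside (R : realType) (P : set (R * R)) : set (R * R) :=
  [set p | exists2 F, is_focus P F & ~ connected_component (~` P) F p].

(* Tangency as the limit of secants: the quotient is the sine of the angle
   between [l] and the secant through [q] and [p]. *)
Definition is_tangent (R : realType) (P : set (R * R)) (q : R * R)
    (l : set (R * R)) : Prop :=
  [/\ is_line l, l q, limit_point P q &
      dist_to_set p l / eucl_dist p q
        @[p --> within (P `\ q) (nbhs q)] --> (0 : R)].

(* The tangent line to [P] at [q], and the empty set if there is none. *)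
Definition tangent_line (R : realType) (P : set (R * R)) (q : R * R) :
    set (R * R) :=
  xget set0 [set l | is_tangent P q l].

Definition nondegenerate_biaffine (R : realType) (b c d : R * R) : Prop :=
  [/\ d != 0, forall k : R, b != k *: d & forall k : R, c != k *: d].

Definition folding_line (R : realType) (b c d : R * R) : set (R * R) :=
  line (det2 b d) (det2 d c) (det2 c b).

Definition above (R : realType) (l : set (R * R)) : set (R * R) :=
  [set p | exists2 y, l (p.1, y) & y <= p.2].
Definition below (R : realType) (l : set (R * R)) : set (R * R) :=
  [set p | exists2 y, l (p.1, y) & p.2 <= y].

Definition star (R : realType) (b c d p : R * R) : R * R :=
  ((det2 c b - det2 d c * p.2) / det2 b d,
   (det2 c b - det2 b d * p.1) / det2 d c).

(* Main.v *)
Require Import Defs.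
From HB Require Import structures.
From mathcomp Require Import all_boot all_order all_algebra.
From mathcomp Require Import all_classical all_reals all_analysis.
From mathcomp Require Import ring lra.

Set Implicit Arguments.
Unset Strict Implicit.
Unset Printing Implicit Defensive.

Import Order.TTheory GRing.Theory Num.Theory.
Import numFieldNormedType.Exports.
Local Open Scope classical_set_scope.
Local Open Scope ring_scope.

(** Let beta, gamma and kappa be the coefficients of the folding line
    [beta x + gamma y = kappa].  The identity
    [gamma b + beta c + kappa d = 0] between three vectors of the plane gives
    [f (x, y) = o + (x + t) g + x t h], where [t] is the abscissa of
    [(x, y)^*] and [g], [h] are multiples of [c], [d].  So, up to the change of
    variables [(x, y) |-> (x, t)] and an affine frame, [f] sends two numbers to
    their sum and product.  The folding line becomes the diagonal [x = t], the
    involution [*] exchanges [x] and [t] (which gives [f p = f p^*] at once),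
    and both families of axis-parallel lines become the lines obtained by fixing
    one of the two numbers.

    The image of the diagonal is the zero set of the discriminant of the
    quadratic polynomial with roots [x] and [t], which is [disc] up to scaling;
    each half plane bounded by the diagonal covers exactly [0 <= disc], because
    a pair of real roots can be ordered either way ([vieta_half_plane]).  It remains to recognise, from
    their metric and topological definitions, the two geometric objects.

    - Tangents.  Two tangents at the same point coincide, since the distances to
      two distinct lines cannot both be negligible with respect to the distance
      to their common point ([tangent_unique]).  That fixing one root equal to
      [s] yields a tangent at [vieta s s] follows from
      [4 D a = det2 (p - q) h ^+ 2] for [p] on the parabola, where [a] is the
      unnormalised equation of the line and [D = det2 g h]: the distance to the
      line is quadratic in the distance to [q] ([is_tangent_parabola]).

    - Outside.  Read in complex numbers, [o + 2 s g + s^2 h] is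
      [h (s + g / h)^2 + (o - g^2 / h)]; squaring maps a line to a parabola with
      focus at the origin, so the focus is [o - g^2 / h], and [disc] is the
      difference of the two squared distances in the focus-directrix equation,
      times [sqnorm h] ([disc_focus_directrix]).  Every line through a focus meets the parabola,
      whereas a point with [0 < disc] lies on a line that misses it; hence any
      focus satisfies [disc < 0] ([disc_neg_focus]).  Finally [disc < 0] is a
      component of the complement: it is convex, and [disc] cannot change sign
      on a connected set without vanishing. *)

(** * Euclidean distance to a line, foci and tangents *)

Section Plane.
Variable R : realType.
Implicit Types (p q u v F : R * R) (l P : set (R * R)).

Lemma det2E u v : det2 u v = u.1 * v.2 - v.1 * u.2.
Proof.
rewrite /det2 (expand_det_row _ 0) !big_ord_recl big_ord0 /cofactor !det_mx11 !mxE /=.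
ring.
Qed.

Definition sqnorm u : R := u.1 ^+ 2 + u.2 ^+ 2.
Definition enorm u : R := Num.sqrt (sqnorm u).

Lemma eucl_distE p q : eucl_dist p q = enorm (p - q).
Proof. by []. Qed.

Lemma sqnorm_ge0 u : 0 <= sqnorm u.
Proof. by rewrite addr_ge0 ?sqr_ge0. Qed.

Lemma enorm_ge0 u : 0 <= enorm u.
Proof. exact: sqrtr_ge0. Qed.

Lemma sqr_enorm u : enorm u ^+ 2 = sqnorm u.
Proof. by rewrite sqr_sqrtr ?sqnorm_ge0. Qed.

Lemma sqnorm_gt0 u : (0 < sqnorm u) = (u != 0).
Proof.
rewrite lt0r sqnorm_ge0 andbT paddr_eq0 ?sqr_ge0 // !sqrf_eq0.
by case: u.
Qed.

Lemma enorm_gt0 u : (0 < enorm u) = (u != 0).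
Proof. by rewrite sqrtr_gt0 sqnorm_gt0. Qed.

Lemma cauchy_schwarz u v : `|u.1 * v.1 + u.2 * v.2| <= enorm u * enorm v.
Proof.
rewrite -(@ler_pXn2r _ 2) ?nnegrE ?mulr_ge0 ?enorm_ge0 //.
rewrite real_normK ?num_real // exprMn !sqr_enorm /sqnorm -subr_ge0.
have -> : (u.1 ^+ 2 + u.2 ^+ 2) * (v.1 ^+ 2 + v.2 ^+ 2)
    - (u.1 * v.1 + u.2 * v.2) ^+ 2 = (u.1 * v.2 - u.2 * v.1) ^+ 2 by ring.
exact: sqr_ge0.
Qed.

(** Cauchy-Schwarz makes the right-hand side a lower bound, and the foot of the
    perpendicular attains it. *)
Lemma dist_to_line (u v w : R) p : (u, v) != 0 ->
  dist_to_set p (line u v w) = `|u * p.1 + v * p.2 - w| / enorm (u, v).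
Proof.
move=> uv0; have n0 : 0 < enorm (u, v) by rewrite enorm_gt0.
have N0 : sqnorm (u, v) != 0 by rewrite gt_eqF // sqnorm_gt0.
set e := u * p.1 + v * p.2 - w.
have lb : lbound [set eucl_dist p q | q in line u v w] (`|e| / enorm (u, v)).
  move=> _ [q lq <-]; rewrite ler_pdivrMr // eucl_distE mulrC.
  have -> : e = (u, v).1 * (p - q).1 + (u, v).2 * (p - q).2.
    by rewrite /e -lq /=; ring.
  exact: cauchy_schwarz.
pose k := e / sqnorm (u, v).
pose q : R * R := (p.1 - k * u, p.2 - k * v).
have lq : line u v w q.
  rewrite /line /q /k /e /=; move: N0; rewrite /sqnorm /= => N0; field.
  by [].
have dq : eucl_dist p q = `|e| / enorm (u, v).
  rewrite eucl_distE.
  apply: (@pexpIrn _ 2); rewrite ?nnegrE ?divr_ge0 ?enorm_ge0 //=.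
  rewrite sqr_enorm exprMn exprVn sqr_enorm real_normK ?num_real //.
  rewrite {1}/sqnorm /q /k /=; move: N0; rewrite /sqnorm /= => N0; field.
  by [].
apply/eqP; rewrite eq_le lb_le_inf ?andbT //; last by exists (eucl_dist p q), q.
rewrite -dq; apply: ge_inf; last by exists q.
by exists (`|e| / enorm (u, v)).
Qed.

Lemma equidistantE (u v w : R) p F : (u, v) != 0 ->
  (eucl_dist p F = dist_to_set p (line u v w)) <->
  sqnorm (u, v) * sqnorm (p - F) = (u * p.1 + v * p.2 - w) ^+ 2.
Proof.
move=> uv0; have n0 : 0 < enorm (u, v) by rewrite enorm_gt0.
rewrite dist_to_line // eucl_distE -!sqr_enorm -exprMn; split=> [->|h].
  by rewrite mulrC divfK ?gt_eqF // real_normK ?num_real.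
apply: (mulIf (lt0r_neq0 n0)); rewrite divfK ?gt_eqF // mulrC.
apply: (@pexpIrn _ 2); rewrite ?nnegrE ?mulr_ge0 ?enorm_ge0 //.
by rewrite /= h real_normK ?num_real.
Qed.

(** With [delta] and [nu] the values of the equation of the directrix at [F] and
    along [u], and [M] the product of the lengths of [u] and of the normal, the
    focus-directrix equation reads [M t = delta + t nu] up to sign.  Of the two
    signs at least one has a solution, because [M > 0]. *)
Lemma line_through_focus P F u : is_focus P F -> u != 0 ->
  exists t : R, P (F + t *: u).
Proof.
move=> [_ [[n1 [n2 [w [n0 ->]]]] lF ->]] u0.
set delta := n1 * F.1 + n2 * F.2 - w.
set nu := n1 * u.1 + n2 * u.2.
set M := enorm (n1, n2) * enorm u.
have M0 : 0 < M by rewrite mulr_gt0 // enorm_gt0.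
have M2 : M ^+ 2 = sqnorm (n1, n2) * sqnorm u by rewrite exprMn !sqr_enorm.
suff [t ht] : exists t, (M * t) ^+ 2 = (delta + t * nu) ^+ 2.
  exists t; apply/(equidistantE _ _ _ n0); rewrite [F + _]addrC addrK.
  transitivity ((M * t) ^+ 2).
    rewrite exprMn M2 -mulrA; congr (_ * _); rewrite /sqnorm /=.
    by rewrite -![_ *: _]/(_ * _); ring.
  rewrite ht /delta /nu /= -![_ *: _]/(_ * _); ring.
have [Mnu|Mnu] := eqVneq M nu.
  exists (- delta / (M + nu)).
  have h : M + nu != 0 by rewrite -Mnu gt_eqF // addr_gt0.
  by field.
exists (delta / (M - nu)); have h : M - nu != 0 by rewrite subr_eq0.
by field.
Qed.

(** If the normals of the two lines were independent, Cramer's rule would bound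
    the distance from [p] to [q] by a fixed multiple of the sum of the distances
    from [p] to the lines, so the two quotients could not both tend to [0] at a
    limit point. *)
Lemma tangent_unique P q l1 l2 :
  is_tangent P q l1 -> is_tangent P q l2 -> l1 = l2.
Proof.
move=> [[u1 [v1 [w1 [n1 ->]]]] q1 lim_q t1] [[u2 [v2 [w2 [n2 ->]]]] q2 _ t2].
have N1 : 0 < enorm (u1, v1) by rewrite enorm_gt0.
have N2 : 0 < enorm (u2, v2) by rewrite enorm_gt0.
set Delta := u1 * v2 - u2 * v1.
have Delta0 : Delta = 0.
  apply/eqP/negPn/negP => Delta0.
  (* [e] bounds the sum of the two quotients from below, [Delta] being the
      determinant of the normals. *)
  pose e := `|Delta| / (enorm (u1, v1) * enorm (u2, v2)).
  have e0 : 0 < e by rewrite divr_gt0 ?mulr_gt0 ?normr_gt0.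
  have : dist_to_set p (line u1 v1 w1) / eucl_dist p q
      + dist_to_set p (line u2 v2 w2) / eucl_dist p q
      @[p --> within (P `\ q) (nbhs q)] --> (0 : R).
    by rewrite -[0]addr0; exact: cvgD.
  move=> /cvgrPdist_lt/(_ _ e0)/lim_q.
  move=> [p [pq Pp /(_ (conj Pp (fun h => negP pq (introT eqP h))))]].
  rewrite /= sub0r normrN; apply/negP; rewrite -leNgt.
  rewrite -mulrDl eucl_distE !dist_to_line //.
  have d0 : 0 < enorm (p - q) by rewrite enorm_gt0 subr_eq0.
  apply: le_trans (ler_norm _).
  rewrite ler_pdivlMr // /e -[X in _ <= X + _](mulfK (lt0r_neq0 N2)).
  rewrite -[X in _ <= _ + X](mulfK (lt0r_neq0 N1)).
  set a := u1 * p.1 + _ - _; set b := u2 * p.1 + _ - _.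
  have -> : `|a| / enorm (u1, v1) * enorm (u2, v2) / enorm (u2, v2)
     + `|b| / enorm (u2, v2) * enorm (u1, v1) / enorm (u1, v1)
     = (`|a| * enorm (u2, v2) + `|b| * enorm (u1, v1))
       / (enorm (u1, v1) * enorm (u2, v2)).
    by move: (lt0r_neq0 N1) (lt0r_neq0 N2) => ? ?; field; apply/andP.
  rewrite mulrAC ler_wpM2r ?invr_ge0 ?mulr_ge0 ?enorm_ge0 //.
  rewrite -(@ler_pXn2r _ 2) ?nnegrE ?addr_ge0 ?mulr_ge0 ?enorm_ge0 //.
  rewrite exprMn sqr_enorm real_normK ?num_real //.
  have -> : Delta ^+ 2 * sqnorm (p - q)
      = a ^+ 2 * sqnorm (u2, v2) + b ^+ 2 * sqnorm (u1, v1)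
        - 2 * (a * b * (u1 * u2 + v1 * v2)).
    by rewrite /a /b -q1 -q2 /Delta /sqnorm /=; ring.
  have -> : (`|a| * enorm (u2, v2) + `|b| * enorm (u1, v1)) ^+ 2
      = a ^+ 2 * sqnorm (u2, v2) + b ^+ 2 * sqnorm (u1, v1)
        + 2 * (`|a| * `|b| * (enorm (u1, v1) * enorm (u2, v2))).
    rewrite -!sqr_enorm -(real_normK (num_real a)) -(real_normK (num_real b)).
    ring.
  rewrite lerD2l -mulrN ler_pM2l //.
  apply: le_trans (ler_norm _) _; rewrite normrN !normrM.
  have := cauchy_schwarz (u1, v1) (u2, v2) => /= cs.
  by rewrite ler_wpM2l ?mulr_ge0.
(* Lines with parallel normals that share the point [q] are equal. *)
have sub (u v w u' v' w' : R) : (u, v) != 0 -> u * v' - u' * v = 0 ->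
    line u v w q -> line u' v' w' q -> line u v w `<=` line u' v' w'.
  move=> n0 D0 lq lq' p lp; apply/eqP; rewrite /line /= -lq' -subr_eq0.
  have N0 : sqnorm (u, v) != 0 by rewrite gt_eqF // sqnorm_gt0.
  rewrite -(mulrI_eq0 _ (lregP N0)) -[X in _ == X](mulr0 (u * u' + v * v')).
  rewrite -[0 in X in _ == X](subrr w) -{1}lp -lq; apply/eqP.
  transitivity ((u * u' + v * v') * (u * p.1 + v * p.2 - (u * q.1 + v * q.2))
    + (u * v' - u' * v) * (u * (p.2 - q.2) - v * (p.1 - q.1))).
    by rewrite /sqnorm /=; ring.
  by rewrite D0 mul0r addr0.
apply/seteqP; split; apply: (sub) => //.
by rewrite -[RHS]oppr0 -Delta0 /Delta; ring.
Qed.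

End Plane.

(** * Sum and product of two numbers in an affine frame *)

Section Vieta.
Variables (R : realType) (o g h : R * R).
Hypothesis gh0 : det2 g h != 0.
Implicit Types (p F : R * R) (s t x : R).

Definition vieta x t : R * R := o + (x + t) *: g + (x * t) *: h.

(** [det2 g h ^+ 2] times the discriminant [u ^+ 2 - 4 * v] of the quadratic
    polynomial with root sum [u] and root product [v], where
    [p = o + u *: g + v *: h].  This scaling avoids divisions and is the one
    that appears in [disc_focus_directrix]. *)
Definition disc p : R := det2 (p - o) h ^+ 2 - 4 * det2 g h * det2 g (p - o).
Definition parabola : set (R * R) := [set p | disc p = 0].

Lemma disc_vieta x t : disc (vieta x t) = (det2 g h * (x - t)) ^+ 2.
Proof. by rewrite /disc /vieta !det2E /= -![_ *: _]/(_ * _); ring. Qed.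

(** [u] and [v] are the coordinates of [p] in the frame, by Cramer's rule. *)
Lemma vieta_inv p (D := det2 g h) (u := det2 (p - o) h / D)
    (v := det2 g (p - o) / D) x t : x + t = u -> x * t = v -> vieta x t = p.
Proof.
rewrite /vieta => -> ->; rewrite /u /v /D; move: gh0; rewrite !det2E /= => D0.
rewrite [RHS]surjective_pairing; congr pair => /=; rewrite -![_ *: _]/(_ * _); by field.
Qed.

Lemma disc_ge0P p : 0 <= disc p -> exists x t, x <= t /\ vieta x t = p.
Proof.
move=> d0; set D := det2 g h; pose u := det2 (p - o) h / D.
pose r := Num.sqrt (disc p / D ^+ 2).
have r2 : r ^+ 2 = u ^+ 2 - 4 * (det2 g (p - o) / D).
  rewrite sqr_sqrtr ?divr_ge0 ?sqr_ge0 // /disc /u -/D.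
  by move: gh0; rewrite -/D => D0; field.
exists ((u - r) / 2), ((u + r) / 2); split.
  by have : 0 <= r := sqrtr_ge0 _; lra.
apply: vieta_inv; first by rewrite /u -/D; field.
by rewrite -[RHS]/(det2 g (p - o) / D); lra.
Qed.

Lemma parabolaP : parabola = range (fun s => vieta s s).
Proof.
apply/seteqP; split=> [p /= p0|_ [s _ <-]]; last first.
  by rewrite /parabola /= disc_vieta subrr mulr0 expr0n.
have [x [t [_ xtp]]] : exists x t, x <= t /\ vieta x t = p.
  by apply: disc_ge0P; rewrite p0.
exists x => //; move/eqP: p0; rewrite -xtp disc_vieta sqrf_eq0 mulf_eq0.
by rewrite (negPf gh0) /= subr_eq0 => /eqP->.
Qed.

Lemma vietaC x t : vieta x t = vieta t x.
Proof. by rewrite /vieta addrC (mulrC x) [LHS]addrC (addrC x). Qed.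

Lemma vieta_inj x t x' t' :
  vieta x t = vieta x' t' -> x + t = x' + t' /\ x * t = x' * t'.
Proof.
have U y s : det2 (vieta y s - o) h = det2 g h * (y + s).
  by rewrite /vieta !det2E /= -![_ *: _]/(_ * _); ring.
have V y s : det2 g (vieta y s - o) = det2 g h * (y * s).
  by rewrite /vieta !det2E /= -![_ *: _]/(_ * _); ring.
by move=> e; split; apply: (mulfI gh0); rewrite -?U -?V e.
Qed.

(** A pair of real roots may be ordered either way, and for any [r] one of the two
    orders satisfies the constraint: each side of the diagonal has the same
    image. *)
Lemma vieta_half_plane r :
  [set vieta xt.1 xt.2 | xt in [set xt | 0 <= r * (xt.1 - xt.2)]]
  = [set p | 0 <= disc p].
Proof.
apply/seteqP; split=> [_ [xt _ <-]|p /= /disc_ge0P[x [t [xt <-]]]].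
  by rewrite /= disc_vieta sqr_ge0.
have [r0|r0] := leP 0 r.
  by exists (t, x); rewrite /= ?mulr_ge0 ?subr_ge0 // vietaC.
by exists (x, t); rewrite //= mulr_le0 ?subr_le0 // ltW.
Qed.

Lemma h_neq0 : h != 0.
Proof. by apply: contra_neq gh0 => ->; rewrite det2E /= !(mulr0, mul0r) subrr. Qed.

(** * Focus and directrix *)

(** The point [o - g ^+ 2 / h] computed in complex numbers; [re] and [im] are the
    parts of [g ^+ 2]. *)
Definition focus : R * R :=
  let re := g.1 ^+ 2 - g.2 ^+ 2 in let im := 2 * g.1 * g.2 in
  (o.1 - (re * h.1 + im * h.2) / sqnorm h,
   o.2 - (im * h.1 - re * h.2) / sqnorm h).
Definition directrix_level : R := h.1 * o.1 + h.2 * o.2 - sqnorm g.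

Lemma disc_focus_directrix p :
  disc p = sqnorm h * sqnorm (p - focus)
           - (h.1 * p.1 + h.2 * p.2 - directrix_level) ^+ 2.
Proof.
have : sqnorm h != 0 by rewrite gt_eqF // sqnorm_gt0 h_neq0.
rewrite /disc !det2E /focus /directrix_level /sqnorm /= => H0.
by field.
Qed.

Lemma focus_off_directrix : ~ line h.1 h.2 directrix_level focus.
Proof.
have H0 : sqnorm h != 0 by rewrite gt_eqF // sqnorm_gt0 h_neq0.
move/eqP; rewrite -subr_eq0; apply/negP.
have -> : h.1 * focus.1 + h.2 * focus.2 - directrix_level
    = 2 * det2 g h ^+ 2 / sqnorm h.
  by move: H0; rewrite /focus /directrix_level /sqnorm det2E /= => H0; field.
by rewrite mulf_neq0 ?invr_eq0 // mulf_neq0 ?pnatr_eq0 // sqrf_eq0.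
Qed.

Lemma is_focus_focus : is_focus parabola focus.
Proof.
have h0 : (h.1, h.2) != 0 by case: h h_neq0.
exists (line h.1 h.2 directrix_level); split; last 1 first.
- apply/seteqP; split=> p /=.
    rewrite /parabola /= disc_focus_directrix => /eqP; rewrite subr_eq0 => /eqP e.
    by apply/equidistantE => //; rewrite -e; case: h.
  move/equidistantE => /(_ h0) e; rewrite /parabola /= disc_focus_directrix -e.
  by case: h {e} => ? ?; rewrite subrr.
- by exists h.1, h.2, directrix_level.
- exact: focus_off_directrix.
Qed.

(** If [0 <= disc F], write [F = vieta x t].  In frame coordinates the parabola
    is [u ^+ 2 = 4 * v] and the line through [F] of slope [(x + t) / 2] misses
    it when [x] and [t] differ; but no line through a focus does.  When [x = t],
    [F] is on the parabola, hence at distance [0] from its directrix, which is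
    excluded. *)
Lemma disc_neg_focus F : is_focus parabola F -> disc F < 0.
Proof.
move=> fF; rewrite ltNge; apply/negP => /disc_ge0P[x [t [xt xtF]]].
pose u := 2 *: g + (x + t) *: h.
have u0 : u != 0.
  have : det2 u h != 0.
    have -> : det2 u h = 2 * det2 g h.
      by rewrite /u !det2E /= -![_ *: _]/(_ * _); ring.
    by rewrite mulf_neq0 ?pnatr_eq0.
  by apply: contra_neq => ->; rewrite det2E /= !(mulr0, mul0r) subrr.
have [r] := line_through_focus fF u0.
have dE : disc (F + r *: u) = det2 g h ^+ 2 * ((x - t) ^+ 2 + 4 * r ^+ 2).
  by rewrite -xtF /disc /vieta /u !det2E /= -![_ *: _]/(_ * _); ring.
rewrite /parabola /= dE => /eqP.
rewrite mulf_eq0 sqrf_eq0 (negPf gh0) /=.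
move=> /eqP e0; have xt_eq : x = t.
  apply/eqP; rewrite -subr_eq0 -sqrf_eq0.
  by have := sqr_ge0 (x - t); have := sqr_ge0 r; lra.
have PF : parabola F by rewrite /parabola /= -xtF disc_vieta xt_eq subrr mulr0 expr0n.
have [_ [[n1 [n2 [w [n0 ->]]]] lF Peq]] := fF.
move: PF; rewrite Peq => /(equidistantE _ _ _ n0) /esym.
rewrite subrr {2}/sqnorm /= expr0n addr0 mulr0 => /eqP; rewrite sqrf_eq0 subr_eq0.
by move/eqP.
Qed.

(** * The outside of the parabola *)

Lemma continuous_disc : continuous disc.
Proof.
move=> p; rewrite /disc.
have -> : (fun q => det2 (q - o) h ^+ 2 - 4 * det2 g h * det2 g (q - o))
  = (fun q : R * R => ((q.1 - o.1) * h.2 - h.1 * (q.2 - o.2)) ^+ 2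
      - 4 * det2 g h * (g.1 * (q.2 - o.2) - (q.1 - o.1) * g.2)).
  by apply/funext => q; rewrite !det2E.
have c1 (a : R) : {for p, continuous (fun q : R * R => q.1 - a)}.
  by apply: cvgB; [exact: cvg_fst|exact: cvg_cst].
have c2 (a : R) : {for p, continuous (fun q : R * R => q.2 - a)}.
  by apply: cvgB; [exact: cvg_snd|exact: cvg_cst].
have cst (a : R) : {for p, continuous (fun=> a)} by exact: cvg_cst.
apply: cvgB.
  apply: (@cvgM _ _ _ _ (fun q : R * R => (q.1 - o.1) * h.2 - h.1 * (q.2 - o.2))
     (fun q : R * R => (q.1 - o.1) * h.2 - h.1 * (q.2 - o.2)));
  by apply: cvgB; apply: cvgM; [exact: c1|exact: cst|exact: cst|exact: c2].
apply: cvgM; first exact: cst.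
by apply: cvgB; apply: cvgM; [exact: cst|exact: c2|exact: c1|exact: cst].
Qed.

(** The Hessian of [disc] is positive semidefinite, of rank one with kernel
    spanned by the axis direction [h]; hence [disc < 0] is convex. *)
Lemma disc_segment p q t :
  disc (p + t *: (q - p)) =
  (1 - t) * disc p + t * disc q - t * (1 - t) * det2 (q - p) h ^+ 2.
Proof. by rewrite /disc !det2E /= -![_ *: _]/(_ * _); ring. Qed.

Lemma connected_component_disc_neg F : disc F < 0 ->
  connected_component (~` parabola) F = [set p | disc p < 0].
Proof.
move=> F0; apply/seteqP; split=> [p [C [CF CP Cc] Cp]|p /= p0].
  rewrite /= ltNge le_eqVlt negb_or; apply/andP; split.
    by apply/negP => /eqP/esym; exact: CP.
  apply/negP => p0.
  have cC : connected (disc @` C).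
    apply: connected_continuous_connected => //.
    exact: continuous_subspaceT continuous_disc.
  have iC := (connected_intervalP (disc @` C)).1 cC.
  have [|||q Cq q0] := iC (disc F) (disc p) _ _ 0.
  - by exists F.
  - by exists p.
  - by rewrite !ltW.
  by move: q0; exact: CP Cq.
exists ((fun t : R => F + t *: (p - F)) @` `[0, 1]); last first.
  exists 1; first by rewrite /= in_itv /= ler01 lexx.
  by rewrite scale1r addrC subrK.
split.
- by exists 0; [rewrite /= in_itv /= ler01 lexx|rewrite scale0r addr0].
- move=> _ [t + <-]; rewrite /= in_itv /= => /andP[t0 t1].
  rewrite /parabola /= disc_segment; apply/eqP; rewrite lt_eqF //.
  have t1' : 0 <= 1 - t by rewrite subr_ge0.
  have := mulr_ge0 (mulr_ge0 t0 t1') (sqr_ge0 (det2 (p - F) h)).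
  by nra.
- apply: connected_continuous_connected; first exact: segment_connected.
  apply: continuous_subspaceT => t; apply: cvgD; first exact: cvg_cst.
  by apply: cvgZl; exact: cvg_id.
Qed.

Lemma outside_parabola : outside parabola = [set p | 0 <= disc p].
Proof.
apply/seteqP; split=> [p [F /disc_neg_focus F0]|p /= p0].
  by rewrite connected_component_disc_neg //= => /negP; rewrite -leNgt.
exists focus; first exact: is_focus_focus.
rewrite connected_component_disc_neg; first by rewrite /= ltNge p0.
by apply: disc_neg_focus; exact: is_focus_focus.
Qed.

(** * Tangents of the parabola *)

Lemma range_vietaE s (k := g + s *: h) (q := vieta s s) :
  range (vieta s) = line (- k.2) k.1 (k.1 * q.2 - k.2 * q.1).
Proof.
rewrite {}/k {}/q; apply/seteqP; split=> [_ [t _ <-]|p /=].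
  by rewrite /line /vieta /= -![_ *: _]/(_ * _); ring.
rewrite /line /= => lp.
exists (det2 (p - o) h / det2 g h - s) => //; apply: vieta_inv => //.
  by rewrite addrC subrK.
have {}lp : det2 g (p - o) = s * det2 (p - o) h - s ^+ 2 * det2 g h.
  apply/eqP; rewrite -subr_eq0; move/eqP: lp; rewrite -subr_eq0 => /eqP lp.
  rewrite -lp !det2E /vieta /= -![_ *: _]/(_ * _); apply/eqP; ring.
by rewrite lp; field.
Qed.

Lemma tangent_dir_neq0 s : g + s *: h != 0.
Proof.
have : det2 (g + s *: h) h != 0.
  suff -> : det2 (g + s *: h) h = det2 g h by [].
  by rewrite !det2E /= -![_ *: _]/(_ * _); ring.
by apply: contra_neq => ->; rewrite det2E /= !(mulr0, mul0r) subrr.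
Qed.

Lemma continuous_enorm : continuous (@enorm R).
Proof.
move=> p; apply: (@continuous_comp _ _ _ (@sqnorm R) Num.sqrt); last exact: sqrt_continuous.
have c1 : {for p, continuous (fun q : R * R => q.1)} by exact: cvg_fst.
have c2 : {for p, continuous (fun q : R * R => q.2)} by exact: cvg_snd.
by apply: cvgD; apply: cvgM.
Qed.

Lemma limit_point_parabola s : limit_point parabola (vieta s s).
Proof.
move=> U nU.
have cv : (fun t => vieta t t) @ s --> vieta s s.
  rewrite /vieta; apply: cvgD.
    apply: cvgD; first exact: cvg_cst.
    by apply: cvgZr_tmp; apply: cvgD; exact: cvg_id.
  by apply: cvgZr_tmp; apply: cvgM; exact: cvg_id.
have /nbhs_ballP[e /= e0 eU] := cv _ nU.
exists (vieta (s + e / 2) (s + e / 2)); split.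
- apply/eqP => /(congr1 (fun p => det2 (p - o) h)).
  rewrite !det2E /vieta /= -![_ *: _]/(_ * _) => /eqP; rewrite -subr_eq0.
  have -> : forall x y z w : R, x - y - (z - w) = x - z + (w - y).
    by move=> *; ring.
  apply/negP; rewrite [X in X != 0](_ : _ = e * det2 g h); last first.
    by rewrite det2E; field.
  by rewrite mulf_neq0 // gt_eqF.
- by rewrite parabolaP //; exists (s + e / 2).
- apply: eU; rewrite /ball /= opprD addrA subrr sub0r normrN gtr0_norm; lra.
Qed.

(** Modulo [disc], the equation of the line is a multiple of the square of a
    linear form vanishing at [q], so on the parabola the distance to the line is
    at most [C] times the squared distance to [q]. *)
Lemma is_tangent_parabola s :
  is_tangent parabola (vieta s s) (range (vieta s)).
Proof.
have k0 := tangent_dir_neq0 s.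
have n0 : (- (g + s *: h).2, (g + s *: h).1) != 0.
  rewrite -sqnorm_gt0 [sqnorm _](_ : _ = sqnorm (g + s *: h)) ?sqnorm_gt0 //.
  by rewrite /sqnorm /= sqrrN addrC.
split.
- by rewrite range_vietaE; do 3!eexists; split; first exact: n0.
- by exists s.
- exact: limit_point_parabola.
set q := vieta s s.
set n := enorm (- (g + s *: h).2, (g + s *: h).1).
have np : 0 < n by rewrite enorm_gt0.
pose C := sqnorm h / (4 * `|det2 g h| * n).
have cq : C * eucl_dist p q @[p --> within (parabola `\ q) (nbhs q)] --> (0 : R).
  apply: cvg_trans (cvg_app _ (cvg_within _)) _.
  have -> : (0 : R) = C * enorm (q - q).
    by rewrite subrr /enorm /sqnorm /= expr0n addr0 sqrtr0 mulr0.
  apply: cvgM; first exact: cvg_cst.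
  apply: (@continuous_comp _ _ _ (fun p => p - q) (@enorm R)).
    by apply: cvgB; [exact: cvg_id|exact: cvg_cst].
  exact: continuous_enorm.
apply: (squeeze_cvgr _ (cvg_cst 0) cq).
rewrite near_withinE; near=> p => -[Pp pq].
have d0 : 0 < eucl_dist p q by rewrite eucl_distE enorm_gt0 subr_eq0; apply/eqP.
rewrite range_vietaE dist_to_line //; apply/andP; split.
  by rewrite !divr_ge0 ?normr_ge0 ?(ltW d0) ?enorm_ge0.
rewrite ler_pdivrMr // ler_pdivrMr // -/n.
rewrite -[C * _ * _]mulrA -expr2 eucl_distE sqr_enorm /C -/q.
set a := - _ * _ + _ - _.
have D0 : 0 < `|det2 g h| by rewrite normr_gt0.
have -> : sqnorm h / (4 * `|det2 g h| * n) * sqnorm (p - q) * n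
    = sqnorm h * sqnorm (p - q) / (4 * `|det2 g h|).
  by move: (lt0r_neq0 D0) (lt0r_neq0 np) => ? ?; field; apply/andP.
rewrite ler_pdivlMr ?mulr_gt0 //.
have aE : 4 * det2 g h * a = det2 (p - q) h ^+ 2 - disc p.
  by rewrite /a /disc /q /vieta !det2E /= -![_ *: _]/(_ * _); ring.
have -> : `|a| * (4 * `|det2 g h|) = `|4 * det2 g h * a|.
  by rewrite !normrM (ger0_norm (_ : 0 <= 4)) // mulrC.
rewrite aE (_ : disc p = 0) // subr0 ger0_norm ?sqr_ge0 //.
rewrite mulrC -subr_ge0.
have -> : sqnorm (p - q) * sqnorm h - det2 (p - q) h ^+ 2
   = ((p - q).1 * h.1 + (p - q).2 * h.2) ^+ 2.
  by rewrite det2E /sqnorm; ring.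
exact: sqr_ge0.
Unshelve. all: by end_near.
Qed.

Lemma tangent_line_parabola s :
  tangent_line parabola (vieta s s) = range (vieta s).
Proof.
apply: xget_unique; first exact: is_tangent_parabola.
by move=> l tl; exact: tangent_unique tl (is_tangent_parabola s).
Qed.

Lemma tangents_meet x t : x <> t ->
  range (vieta x) `&` range (vieta t) = [set vieta x t].
Proof.
move=> xt; apply/seteqP; split=> [_ [[s _ <-] [s' _ /vieta_inj[e1 e2]]]|_ ->].
  have /eqP : (x - t) * (s - t) = 0.
    have s'E : s' = x + s - t by lra.
    by move: e2; rewrite s'E; nra.
  rewrite mulf_eq0 !subr_eq0 => /orP[/eqP//|/eqP->].
  by [].
by split; [exists t|rewrite vietaC; exists x].
Qed.


End Vieta.

(** * Bi-affine maps as sum and product *)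

Lemma det2_neq0 (R : realType) (u d : R * R) :
  d != 0 -> (forall k, u != k *: d) -> det2 u d != 0.
Proof.
move=> d0 ud; apply/eqP => D0.
have /eqP[] := ud ((u.1 * d.1 + u.2 * d.2) / sqnorm d).
have N0 : sqnorm d != 0 by rewrite gt_eqF // sqnorm_gt0.
have E1 : u.1 * sqnorm d = (u.1 * d.1 + u.2 * d.2) * d.1 + det2 u d * d.2.
  by rewrite det2E /sqnorm; ring.
have E2 : u.2 * sqnorm d = (u.1 * d.1 + u.2 * d.2) * d.2 - det2 u d * d.1.
  by rewrite det2E /sqnorm; ring.
rewrite [LHS]surjective_pairing; congr pair.
  by rewrite /= -![_ *: _]/(_ * _) mulrAC -[LHS](mulfK N0) E1 D0 mul0r addr0.
by rewrite /= -![_ *: _]/(_ * _) mulrAC -[LHS](mulfK N0) E2 D0 mul0r subr0.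
Qed.

Section BiAffine.
Variables (R : realType) (a b c d : R * R).
Hypotheses (bd0 : det2 b d != 0) (dc0 : det2 d c != 0).
Local Notation beta := (det2 b d).
Local Notation gamma := (det2 d c).
Local Notation kappa := (det2 c b).
Implicit Types (p q : R * R) (x t y : R).

Definition vieta_o := a + (kappa / gamma) *: c.
Definition vieta_g := - (beta / gamma) *: c.
Definition vieta_h := - (beta / gamma) *: d.

Definition star_x p := (star b c d p).1.

(** The inverse of the change of variables [p |-> (p.1, star_x p)], obtained by
    solving [beta * t = kappa - gamma * y] for the ordinate [y]. *)
Definition vieta_point x t : R * R := (x, (kappa - beta * t) / gamma).

Lemma vieta_frame_free : det2 vieta_g vieta_h != 0.
Proof.
rewrite /vieta_g /vieta_h; set r := - (beta / gamma).
have -> : det2 (r *: c) (r *: d) = - (r ^+ 2 * det2 d c).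
  by rewrite !det2E /= -![_ *: _]/(_ * _); ring.
by rewrite oppr_eq0 mulf_neq0 // sqrf_eq0 oppr_eq0 mulf_neq0 ?invr_eq0.
Qed.

(** The Cramer identity [gamma *: b + beta *: c + kappa *: d = 0] eliminates [b]. *)
Lemma biaffine_vieta x y :
  a + x *: b + y *: c + (x * y) *: d =
  vieta vieta_o vieta_g vieta_h x (star_x (x, y)).
Proof.
move: bd0 dc0.
rewrite /vieta /vieta_o /vieta_g /vieta_h /star_x /star !det2E.
move=> B0 G0; congr pair; rewrite /= -![_ *: _]/(_ * _); field; exact/andP.
Qed.

Lemma star_x_vieta_point x t : star_x (vieta_point x t) = t.
Proof.
rewrite /star_x /star /vieta_point /=; move: bd0 dc0 => B0 G0.
by field; apply/andP.
Qed.

Lemma vieta_point_star_x p : vieta_point p.1 (star_x p) = p.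
Proof.
rewrite /star_x /star /vieta_point /=; move: bd0 dc0 => B0 G0.
rewrite [RHS]surjective_pairing; congr pair.
by field; apply/andP.
Qed.

Lemma starE p : star b c d p = vieta_point (star_x p) p.1.
Proof. by []. Qed.

Lemma folding_lineE p : folding_line b c d p <-> star_x p = p.1.
Proof.
rewrite /folding_line /line /star_x /star /=; split=> [<-|<-].
  by rewrite addrK mulrC mulKf.
by rewrite mulrC divfK // subrK.
Qed.

Lemma height_over_folding_line p :
  p.2 - (vieta_point p.1 p.1).2 = beta / gamma * (p.1 - star_x p).
Proof.
rewrite -[in p.2](vieta_point_star_x p) /vieta_point /=.
by move: dc0; set G := gamma => G0; field.
Qed.

Lemma folding_line_ordinate x y :
  folding_line b c d (x, y) <-> y = (vieta_point x x).2.
Proof.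
split=> [/folding_lineE /= e|->].
  by rewrite -[y]/((x, y).2) -[in LHS](vieta_point_star_x (x, y)) e.
by apply/folding_lineE; exact: star_x_vieta_point.
Qed.

Lemma aboveE p : above (folding_line b c d) p <->
  0 <= beta / gamma * (p.1 - star_x p).
Proof.
rewrite -height_over_folding_line subr_ge0.
split=> [[y /folding_line_ordinate->] //|h].
by exists (vieta_point p.1 p.1).2 => //; apply/folding_line_ordinate.
Qed.

Lemma belowE p : below (folding_line b c d) p <->
  0 <= - (beta / gamma) * (p.1 - star_x p).
Proof.
rewrite mulNr -height_over_folding_line opprB subr_ge0.
split=> [[y /folding_line_ordinate->] //|h].
by exists (vieta_point p.1 p.1).2 => //; apply/folding_line_ordinate.
Qed.

End BiAffine.

Theorem theorem2 (R : realType) (a b c d : R * R) (f : R * R -> R * R)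
    (f_biaffine : forall x y : R,
       f (x, y) = a + x *: b + y *: c + (x * y) *: d)
    (f_nondeg : nondegenerate_biaffine b c d) :
  let Lf := folding_line b c d in
  let Pf := f @` Lf in
  let T := fun A : R * R => tangent_line Pf (f A) in
  [/\ (forall A : R * R, Lf A ->
         T A = f @` vertical_line A.1 /\ f @` vertical_line A.1 = f @` horizontal_line A.2),
      (forall p : R * R, exists A B : R * R,
         [/\ Lf `&` vertical_line p.1 = [set A],
             Lf `&` horizontal_line p.2 = [set B],
             (T A `&` T B) (f p)
           & ~ Lf p -> T A `&` T B = [set f p]])
    & [/\ f @` above Lf = outside Pf,
          f @` below Lf = outside Pf
        & forall p : R * R, f p = f (star b c d p)]].
Proof.
have [d0 b_d c_d] := f_nondeg.
have bd0 : det2 b d != 0 by exact: det2_neq0.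
have dc0 : det2 d c != 0.
  have -> : det2 d c = - det2 c d by rewrite !det2E; ring.
  by rewrite oppr_eq0; exact: det2_neq0.
have gh0 := vieta_frame_free bd0 dc0.
set o := vieta_o a b c d in gh0 *; set g := vieta_g b c d in gh0 *.
set h := vieta_h b c d in gh0 *.
pose S := star_x b c d; pose pt := vieta_point b c d.
have fE p : f p = vieta o g h p.1 (S p).
  by rewrite [p in LHS]surjective_pairing f_biaffine biaffine_vieta // -surjective_pairing.
have ptK p : pt p.1 (S p) = p by exact: vieta_point_star_x.
have Spt x t : S (pt x t) = t by exact: star_x_vieta_point.
have f_pt x t : f (pt x t) = vieta o g h x t by rewrite fE Spt.
move=> Lf Pf T.
have LfE p : Lf p <-> S p = p.1 by exact: folding_lineE.
have PfE : Pf = parabola o g h.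
  rewrite parabolaP //; apply/seteqP; split=> [_ [p /LfE Sp <-]|_ [s _ <-]].
    by exists p.1 => //; rewrite fE Sp.
  by exists (pt s s); rewrite ?f_pt //; apply/LfE; exact: Spt.
have TE A : Lf A -> T A = range (vieta o g h A.1).
  by move=> /LfE SA; rewrite /T PfE fE SA tangent_line_parabola.
have vertE s : f @` vertical_line s = range (vieta o g h s).
  apply/seteqP; split=> [_ [p <- <-]|_ [t _ <-]]; first by exists (S p); rewrite ?fE.
  by exists (pt s t); rewrite ?f_pt.
have horE p : f @` horizontal_line p.2 = range (vieta o g h (S p)).
  apply/seteqP; split=> [_ [q qp <-]|_ [t _ <-]].
    have Sq : S q = S p by rewrite /S /star_x /star /= qp.
    by exists q.1; rewrite // fE Sq vietaC.
  exists (pt t (S p)); last by rewrite f_pt vietaC.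
  by rewrite /horizontal_line /= -[in RHS](ptK p).
have imageE (r : R) (H : set (R * R)) :
    (forall p, H p <-> 0 <= r * (p.1 - S p)) -> f @` H = outside Pf.
  move=> HE; rewrite PfE outside_parabola // -(vieta_half_plane o gh0 r).
  apply/seteqP; split=> [_ [p /HE Hp <-]|_ [xt Hxt <-]].
    by exists (p.1, S p); rewrite ?fE.
  by exists (pt xt.1 xt.2); rewrite ?f_pt //; apply/HE; rewrite Spt.
split.
- move=> A LA; rewrite TE // vertE horE; split=> //.
  by move/LfE: LA => ->.
- move=> p; exists (pt p.1 p.1), (pt (S p) (S p)).
  have LA : Lf (pt p.1 p.1) by apply/LfE; exact: Spt.
  have LB : Lf (pt (S p) (S p)) by apply/LfE; exact: Spt.
  rewrite !TE //=; split.
  + apply/seteqP; split=> [q [/LfE Sq qp]|_ ->]; last by split.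
    by rewrite /= -(ptK q) Sq qp.
  + apply/seteqP; split=> [q [/LfE Sq qp]|_ ->]; last first.
      by split=> //; rewrite /horizontal_line /= -[in RHS](ptK p).
    have Sqp : S q = S p by rewrite /S /star_x /star /= qp.
    by rewrite /= -(ptK q) -Sq Sqp.
  + rewrite fE; split; first by exists (S p).
    by exists p.1; rewrite // vietaC.
  + by move=> nLp; rewrite tangents_meet -?fE // => e; apply/nLp/LfE.
- split.
  + by apply: imageE => p; exact: aboveE.
  + by apply: imageE => p; exact: belowE.
  + by move=> p; rewrite (fE p) starE f_pt vietaC.
Qed.
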